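(* Consider the two-dimensional semi-discrete finite volume scheme for the Euler equations with gravity together with the boundary conditions (periodic, solid wall, transmissive), as described in the context. Assume that the gravity is acting along the $y$ axis and that the initial condition is a function of the $y$ coordinate only. If the initial condition satisfies $$u_{i,j}=\text{const},\qquad v_{i,j}=0,\qquad p_{i,j}\exp(-\psi_{i,j})=\text{const},$$ then it is exactly preserved by the numerical scheme.
   Context: Equations. $\partial_t q+\partial_x f+\partial_y g=s$ with $q=[\rho,\rho u,\rho v,E]^\top$, $f=[\rho u,\;p+\rho u^2,\;\rho uv,\;(E+p)u]^\top$, $g=[\rho v,\;\rho uv,\;p+\rho v^2,\;(E+p)v]^\top$, $s=[0,\alpha,\beta,u\alpha+v\beta]^\top$, $\alpha=-\rho\,\partial_x\phi$, $\beta=-\rho\,\partial_y\phi$. Here $\rho$ is density, $(u,v)$ velocity, $p$ pressure, $\phi$ a given gravitational potential, and $E=\rho\varepsilon+\frac12\rho(u^2+v^2)$ with $\varepsilon$ the internal energy per unit mass. The equation of state is written $p=\rho\theta$ with $\theta$ a function of the thermodynamic variables. Primitive variables: $[\rho,u,v,p]^\top$. Grid. Points $x_i=x_{\min}+(i-1)\Delta x$, $1\le i\le N_x$, and $y_j=y_{\min}+(j-1)\Delta y$, $1\le j\le N_y$, with $\Delta x=(x_{\max}-x_{\min})/(N_x-1)$ and $\Delta y=(y_{\max}-y_{\min})/(N_y-1)$, so there are grid points on the boundary. The cell of $(i,j)$ is $[x_{i-1/2},x_{i+1/2}]\times[y_{j-1/2},y_{j+1/2}]$ with $x_{i\pm1/2}=x_i\pm\frac12\Delta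 x$, $y_{j\pm1/2}=y_j\pm\frac12\Delta y$, except that cells of points on a solid wall have only half the size in the wall-normal direction (e.g. $[x_{i-1/2},x_{i+1/2}]\times[y_{\min},y_{\min}+\frac12\Delta y]$ at the bottom). Put $\phi_{i,j}=\phi(x_i,y_j)$ and let $\theta_{i,j}$ be the value of $\theta$ at $(i,j)$. The function $\psi_h$. $\psi_h(x,y)=-\int^{(x,y)}\frac{\nabla\phi_h\cdot\mathrm{d}r'}{\theta_h}$, where the path is along the $x$ axis for the reconstruction at faces $(i+\frac12,j)$ and along the $y$ axis for the reconstruction at faces $(i,j+\frac12)$. Along the grid line concerned, $\phi_h$ is the one-dimensional continuous piecewise linear interpolant of the values $\phi_{i,j}$ and $\theta_h$ is piecewise constant, equal to $\theta_{i,j}$ in the cell of $(i,j)$. The lower limit is arbitrary (only differences matter), and $\psi_{i,j}$ is the value of $\psi_h$ at $(x_i,y_j)$. Interior scheme. $$\frac{\mathrm{d}q_{i,j}}{\mathrm{d}t}+\frac{\hat f_{i+\frac12,j}-\hat f_{i-\frac12,j}}{\Delta x}+\frac{\hat g_{i,j+\frac12}-\hat g_{i,j-\frac12}}{\Delta y}=[0,\;\alpha_{i,j},\;\beta_{i,j},\;u_{i,j}\alpha_{i,j}+v_{i,j}\beta_{i,j}]^\top,$$ $$\alpha_{i,j}=\frac{\bar p^L_{i+\frac12,j}-\bar p^R_{i-\frac12,j}}{\Delta x},\qquad \beta_{i,j}=\frac{\bar p^L_{i,j+\frac12}-\bar p^R_{i,j-\frac12}}{\Delta y},$$ $$\bar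 p^L_{i+\frac12,j}=p_{i,j}e^{-\frac{\phi_{i+1,j}-\phi_{i,j}}{2\theta_{i,j}}},\quad \bar p^R_{i-\frac12,j}=p_{i,j}e^{\frac{\phi_{i,j}-\phi_{i-1,j}}{2\theta_{i,j}}},\quad \bar p^L_{i,j+\frac12}=p_{i,j}e^{-\frac{\phi_{i,j+1}-\phi_{i,j}}{2\theta_{i,j}}},\quad \bar p^R_{i,j-\frac12}=p_{i,j}e^{\frac{\phi_{i,j}-\phi_{i,j-1}}{2\theta_{i,j}}}.$$ Numerical fluxes. $\hat f$, $\hat g$ at a face are functions of the two reconstructed primitive states there, are consistent with $f$, $g$, and satisfy the contact property: if the two states have the same pressure $p$, the same tangential velocity and zero normal velocity (densities may differ), the flux is $[0,p,0,0]^\top$ for $\hat f$ and $[0,0,p,0]^\top$ for $\hat g$. Reconstruction. The one-dimensional procedure is applied along each coordinate direction: at a face, take $\psi_h$ along the corresponding grid line relative to that face (so $\psi_h=0$ there), form $w=[\rho e^{-\psi_h},u,v,pe^{-\psi_h}]^\top$ at the two grid points on each side, and obtain the face values $w^L$, $w^R$ by any one-dimensional reconstruction scheme (e.g. the minmod scheme); these are converted to primitive variables. Boundary conditions. (i) Periodic, e.g. in $x$: ghost values $q_{i,j}=q_{N_x+i-1,j}$ for $i=-1,0$ and $q_{i,j}=q_{i+1-N_x,j}$ for $i=N_x+1,N_x+2$; points on the periodic boundaries have full cells and are updated by the interior scheme. (ii) Transmissive: the $w$ variables at the two ghost points are set equal to those at the boundary point, e.g. $w_{i,j}=w_{1,j}$,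 $i=-1,0$, at the left, or $w_{i,j}=w_{i,1}$, $j=-1,0$, at the bottom; boundary cells are full and updated by the interior scheme. (iii) Solid wall: a no-penetration condition is enforced, i.e. the normal component of velocity should be zero at the boundary. For example, at a bottom wall ($j=1$): $$\frac{\mathrm{d}q_{i,1}}{\mathrm{d}t}+\frac{\hat f_{i+\frac12,1}-\hat f_{i-\frac12,1}}{\Delta x}+\frac{\hat g_{i,\frac32}-\hat g_{i,1}}{\frac12\Delta y}=[0,\;\alpha_{i,1},\;\beta_{i,1},\;u_{i,1}\alpha_{i,1}]^\top,$$ $$\alpha_{i,1}=\frac{\bar p^L_{i+\frac12,1}-\bar p^R_{i-\frac12,1}}{\Delta x},\qquad \beta_{i,1}=\frac{\bar p^L_{i,\frac32}-p_{i,1}}{\frac12\Delta y},$$ with wall flux $\hat g_{i,1}=[0,0,p_{i,1},0]^\top$ and wall pressure $p_{i,1}=(\gamma-1)\left(E_{i,1}-\frac12\rho_{i,1}u_{i,1}^2\right)$, $\gamma$ being the specific heat ratio. The $w$ variables at the wall point are $w_{i,1}=[\rho_{i,1}e^{-\psi_{i,1}},\,u_{i,1},\,0,\,p_{i,1}e^{-\psi_{i,1}}]^\top$ with $\psi_{i,1}$ taken relative to the face $(i,\frac32)$, and the two states at that face are $w^L_{i,\frac32}=w_{i,1}$ and $$w^R_{i,\frac32}=w_{i,2}-\tfrac12 M\big(\kappa(w_{i,2}-w_{i,1}),\,(w_{i,3}-w_{i,1})/2,\,\kappa(w_{i,3}-w_{i,2})\big),$$ with $\kappa\in[1,2]$ and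 $M$ the componentwise minmod function: $M(a,b,c)=\sigma\min(|a|,|b|,|c|)$ if $a,b,c$ all have the same sign $\sigma$, and $0$ otherwise. *)

(* Defs.v *)
(* Stdlib real numbers with Coquelicot. *)
From Stdlib Require Import Reals ZArith.
From Coquelicot Require Import Coquelicot.
Open Scope R_scope.

(* One type for the conserved variables (rho, rho u, rho v, E), the primitive
   variables (rho, u, v, p), the reconstructed variables
   w = (rho e^-psi, u, v, p e^-psi), and the fluxes and sources. *)
Record vec4 := Vec4 { c1 : R; c2 : R; c3 : R; c4 : R }.

Definition vmap2 (f : R -> R -> R) (a b : vec4) : vec4 :=
  Vec4 (f (c1 a) (c1 b)) (f (c2 a) (c2 b)) (f (c3 a) (c3 b)) (f (c4 a) (c4 b)).
Definition vadd : vec4 -> vec4 -> vec4 := vmap2 Rplus.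
Definition vsub : vec4 -> vec4 -> vec4 := vmap2 Rminus.
Definition vscale (r : R) (a : vec4) : vec4 :=
  Vec4 (r * c1 a) (r * c2 a) (r * c3 a) (r * c4 a).

Inductive side_bc := Transmissive | Wall.
Inductive axis_bc := Periodic | Bounded (lo hi : side_bc).

Definition is_wall (s : side_bc) : bool :=
  match s with Wall => true | Transmissive => false end.
Definition lo_wall (b : axis_bc) : bool :=
  match b with Bounded lo _ => is_wall lo | Periodic => false end.
Definition hi_wall (b : axis_bc) : bool :=
  match b with Bounded _ hi => is_wall hi | Periodic => false end.

Definition on_wall (b : axis_bc) (n i : Z) : bool :=
  ((lo_wall b && (i =? 1)%Z) || (hi_wall b && (i =? n)%Z))%bool.

(* Grid points are numbered 1..n; this sends an index, possibly that of a
   ghost point -1, 0, n+1, n+2, to the grid point it takes its data from. *)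
Definition ghost_src (b : axis_bc) (n i : Z) : Z :=
  match b with
  | Periodic =>
      if (i <? 1)%Z then (n + i - 1)%Z
      else if (n <? i)%Z then (i + 1 - n)%Z else i
  | Bounded _ _ => Z.max 1 (Z.min n i)
  end.

Definition minmod (a b c : R) : R :=
  if Req_EM_T (sign a) (sign b) then
    if Req_EM_T (sign b) (sign c) then
      sign a * Rmin (Rabs a) (Rmin (Rabs b) (Rabs c))
    else 0
  else 0.

Definition vminmod (a b c : vec4) : vec4 :=
  Vec4 (minmod (c1 a) (c1 b) (c1 c)) (minmod (c2 a) (c2 b) (c2 c))
       (minmod (c3 a) (c3 b) (c3 c)) (minmod (c4 a) (c4 b) (c4 c)).

(* A scalar reconstruction: from the values at the two grid points on each side
   of a face, listed in increasing coordinate, to a value at the face. *)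
Definition recon1d := R -> R -> R -> R -> R.

Definition vrecon (r : recon1d) (a b c d : vec4) : vec4 :=
  Vec4 (r (c1 a) (c1 b) (c1 c) (c1 d)) (r (c2 a) (c2 b) (c2 c) (c2 d))
       (r (c3 a) (c3 b) (c3 c) (c3 d)) (r (c4 a) (c4 b) (c4 c) (c4 d)).

(* A horizontal or vertical grid line: its points, and along it the potential
   at all integer indices, and theta and the primitive variables at 1..ln_n. *)
Record line := Line {
  ln_n : Z;
  ln_min : R;
  ln_step : R;
  ln_bc : axis_bc;
  ln_phi : Z -> R;
  ln_theta : Z -> R;
  ln_prim : Z -> vec4
}.

Definition node (l : line) (i : Z) : R := ln_min l + IZR (i - 1) * ln_step l.

(* In all that follows the face with index k is the face k+1/2. *)
Definition face (l : line) (k : Z) : R := node l k + ln_step l / 2.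

Definition phi_h (l : line) (s : R) : R :=
  let r := (s - ln_min l) / ln_step l in
  let i := (Int_part r + 1)%Z in
  ln_phi l i + (r - IZR (i - 1)) * (ln_phi l (i + 1)%Z - ln_phi l i).

(* The index computed here is that of the cell containing s; the half-size of
   wall cells only cuts off points outside the domain. *)
Definition theta_h (l : line) (s : R) : R :=
  let i := (Int_part ((s - ln_min l) / ln_step l + / 2) + 1)%Z in
  ln_theta l (ghost_src (ln_bc l) (ln_n l) i).

(* psi_h along the line, with lower limit a. *)
Definition psi_h (l : line) (a s : R) : R :=
  - RInt (fun r => Derive (phi_h l) r / theta_h l r) a s.

Definition to_w (psi : R) (p : vec4) : vec4 :=
  Vec4 (c1 p * exp (- psi)) (c2 p) (c3 p) (c4 p * exp (- psi)).
Definition of_w (psi : R) (w : vec4) : vec4 :=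
  Vec4 (c1 w * exp psi) (c2 w) (c3 w) (c4 w * exp psi).

(* w at point i relative to face k. At a transmissive end the w variables
   themselves are copied to the ghost points; at a periodic end the conserved
   variables are, and psi_h is evaluated at the ghost point. *)
Definition w_at (l : line) (k i : Z) : vec4 :=
  let m := match ln_bc l with
           | Periodic => i
           | Bounded _ _ => ghost_src (ln_bc l) (ln_n l) i
           end in
  to_w (psi_h l (face l k) (node l m))
       (ln_prim l (ghost_src (ln_bc l) (ln_n l) m)).

Definition at_lo_face (l : line) (k : Z) : bool :=
  (lo_wall (ln_bc l) && (k =? 1)%Z)%bool.
Definition at_hi_face (l : line) (k : Z) : bool :=
  (hi_wall (ln_bc l) && (k =? ln_n l - 1)%Z)%bool.

Definition w_left (rL : recon1d) (kappa : R) (l : line) (k : Z) : vec4 :=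
  let w := w_at l k in
  let n := ln_n l in
  if at_lo_face l k then w 1%Z
  else if at_hi_face l k then
    vadd (w (n - 1)%Z)
      (vscale (/ 2)
        (vminmod (vscale kappa (vsub (w n) (w (n - 1)%Z)))
                 (vscale (/ 2) (vsub (w n) (w (n - 2)%Z)))
                 (vscale kappa (vsub (w (n - 1)%Z) (w (n - 2)%Z)))))
  else vrecon rL (w (k - 1)%Z) (w k) (w (k + 1)%Z) (w (k + 2)%Z).

Definition w_right (rR : recon1d) (kappa : R) (l : line) (k : Z) : vec4 :=
  let w := w_at l k in
  if at_lo_face l k then
    vsub (w 2%Z)
      (vscale (/ 2)
        (vminmod (vscale kappa (vsub (w 2%Z) (w 1%Z)))
                 (vscale (/ 2) (vsub (w 3%Z) (w 1%Z)))
                 (vscale kappa (vsub (w 3%Z) (w 2%Z)))))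
  else if at_hi_face l k then w (ln_n l)
  else vrecon rR (w (k - 1)%Z) (w k) (w (k + 1)%Z) (w (k + 2)%Z).

Definition face_flux (F : vec4 -> vec4 -> vec4) (rL rR : recon1d) (kappa : R)
    (l : line) (k : Z) : vec4 :=
  let psi := psi_h l (face l k) (face l k) in
  F (of_w psi (w_left rL kappa l k)) (of_w psi (w_right rR kappa l k)).

(* The flux difference quotient in the cell of point i; wf p is the flux
   through a solid wall with wall pressure p. *)
Definition flux_div (F : vec4 -> vec4 -> vec4) (wf : R -> vec4)
    (rL rR : recon1d) (kappa : R) (l : line) (i : Z) : vec4 :=
  let fl := face_flux F rL rR kappa l in
  let d := ln_step l in
  let wall := wf (c4 (ln_prim l i)) in
  if (lo_wall (ln_bc l) && (i =? 1)%Z)%bool then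
    vscale (/ (d / 2)) (vsub (fl 1%Z) wall)
  else if (hi_wall (ln_bc l) && (i =? ln_n l)%Z)%bool then
    vscale (/ (d / 2)) (vsub wall (fl (i - 1)%Z))
  else vscale (/ d) (vsub (fl i) (fl (i - 1)%Z)).

(* pbar^L at i+1/2 and pbar^R at i-1/2, both built from the point i. *)
Definition pbarL (l : line) (i : Z) : R :=
  c4 (ln_prim l i)
  * exp (- ((ln_phi l (i + 1)%Z - ln_phi l i) / (2 * ln_theta l i))).
Definition pbarR (l : line) (i : Z) : R :=
  c4 (ln_prim l i)
  * exp ((ln_phi l i - ln_phi l (i - 1)%Z) / (2 * ln_theta l i)).

(* alpha on horizontal lines, beta on vertical ones. *)
Definition grav_force (l : line) (i : Z) : R :=
  let d := ln_step l in
  if (lo_wall (ln_bc l) && (i =? 1)%Z)%bool then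
    (pbarL l i - c4 (ln_prim l i)) / (d / 2)
  else if (hi_wall (ln_bc l) && (i =? ln_n l)%Z)%bool then
    (c4 (ln_prim l i) - pbarR l i) / (d / 2)
  else (pbarL l i - pbarR l i) / d.

Record scheme := Scheme {
  Nx : Z;
  Ny : Z;
  xmin : R;
  xmax : R;
  ymin : R;
  ymax : R;
  bcx : axis_bc;                    (* left and right ends *)
  bcy : axis_bc;                    (* bottom and top ends *)
  phi : R -> R -> R;                (* also used at ghost points *)
  theta : R -> R -> R;              (* function of (rho, epsilon) *)
  gamma : R;
  fhat : vec4 -> vec4 -> vec4;      (* of the left and right primitive states *)
  ghat : vec4 -> vec4 -> vec4;
  recL : recon1d;
  recR : recon1d;
  kappa : R
}.

Definition dx (S : scheme) : R := (xmax S - xmin S) / IZR (Nx S - 1).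
Definition dy (S : scheme) : R := (ymax S - ymin S) / IZR (Ny S - 1).

Definition xpt (S : scheme) (i : Z) : R := xmin S + IZR (i - 1) * dx S.
Definition ypt (S : scheme) (j : Z) : R := ymin S + IZR (j - 1) * dy S.

Definition on_grid (S : scheme) (i j : Z) : Prop :=
  (1 <= i <= Nx S)%Z /\ (1 <= j <= Ny S)%Z.

(* Values of the conserved variables; only those at grid points matter. *)
Definition gridfun := Z -> Z -> vec4.

Definition wall_x (S : scheme) (i : Z) : bool := on_wall (bcx S) (Nx S) i.
Definition wall_y (S : scheme) (j : Z) : bool := on_wall (bcy S) (Ny S) j.

(* The normal velocity used by the scheme at a wall point is zero. *)
Definition vel_x (S : scheme) (q : gridfun) (i j : Z) : R :=
  if wall_x S i then 0 else c2 (q i j) / c1 (q i j).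
Definition vel_y (S : scheme) (q : gridfun) (i j : Z) : R :=
  if wall_y S j then 0 else c3 (q i j) / c1 (q i j).

(* E - rho (u^2 + v^2) / 2; the normal velocity drops out at a wall. *)
Definition rho_eps (S : scheme) (q : gridfun) (i j : Z) : R :=
  c4 (q i j)
  - / 2 * c1 (q i j) * ((vel_x S q i j) ^ 2 + (vel_y S q i j) ^ 2).

Definition theta_at (S : scheme) (q : gridfun) (i j : Z) : R :=
  theta S (c1 (q i j)) (rho_eps S q i j / c1 (q i j)).

(* For the ideal gas, theta rho eps = (gamma - 1) * eps, the wall pressure is
   the pressure given by the equation of state. *)
Definition pres (S : scheme) (q : gridfun) (i j : Z) : R :=
  if (wall_x S i || wall_y S j)%bool then (gamma S - 1) * rho_eps S q i j
  else c1 (q i j) * theta_at S q i j.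

Definition prim (S : scheme) (q : gridfun) (i j : Z) : vec4 :=
  Vec4 (c1 (q i j)) (vel_x S q i j) (vel_y S q i j) (pres S q i j).

Definition row (S : scheme) (q : gridfun) (j : Z) : line :=
  Line (Nx S) (xmin S) (dx S) (bcx S)
    (fun i => phi S (xpt S i) (ypt S j))
    (fun i => theta_at S q i j) (fun i => prim S q i j).
Definition column (S : scheme) (q : gridfun) (i : Z) : line :=
  Line (Ny S) (ymin S) (dy S) (bcy S)
    (fun j => phi S (xpt S i) (ypt S j))
    (fun j => theta_at S q i j) (fun j => prim S q i j).

(* psi_{i,j} along the y axis, with lower limit y = b. *)
Definition psi_y (S : scheme) (q : gridfun) (b : R) (i j : Z) : R :=
  psi_h (column S q i) b (ypt S j).

Definition wall_flux_x (p : R) : vec4 := Vec4 0 p 0 0.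
Definition wall_flux_y (p : R) : vec4 := Vec4 0 0 p 0.

Definition source (S : scheme) (q : gridfun) (i j : Z) : vec4 :=
  let alpha := grav_force (row S q j) i in
  let beta := grav_force (column S q i) j in
  Vec4 0 alpha beta (vel_x S q i j * alpha + vel_y S q i j * beta).

(* dq_{i,j}/dt as prescribed by the scheme. *)
Definition scheme_rhs (S : scheme) (q : gridfun) (i j : Z) : vec4 :=
  vsub (vsub (source S q i j)
    (flux_div (fhat S) wall_flux_x (recL S) (recR S) (kappa S) (row S q j) i))
    (flux_div (ghat S) wall_flux_y (recL S) (recR S) (kappa S)
       (column S q i) j).

Definition no_penetration (S : scheme) (q : gridfun) : Prop :=
  forall i j, on_grid S i j ->
    (wall_x S i = true -> c2 (q i j) = 0) /\
    (wall_y S j = true -> c3 (q i j) = 0).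

Definition is_solution (S : scheme) (q : R -> gridfun) : Prop :=
  forall t : R,
    no_penetration S (q t) /\
    forall i j, on_grid S i j ->
      is_derive (fun s => c1 (q s i j)) t (c1 (scheme_rhs S (q t) i j)) /\
      is_derive (fun s => c2 (q s i j)) t (c2 (scheme_rhs S (q t) i j)) /\
      is_derive (fun s => c3 (q s i j)) t (c3 (scheme_rhs S (q t) i j)) /\
      is_derive (fun s => c4 (q s i j)) t (c4 (scheme_rhs S (q t) i j)).

Definition exactly_preserved (S : scheme) (q0 : gridfun) : Prop :=
  is_solution S (fun _ => q0).

Definition euler_f (u p : R) (q : vec4) : vec4 :=
  Vec4 (c2 q) (p + c2 q * u) (c3 q * u) ((c4 q + p) * u).
Definition euler_g (v p : R) (q : vec4) : vec4 :=
  Vec4 (c3 q) (c2 q * v) (p + c3 q * v) ((c4 q + p) * v).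

Definition consistent_fluxes (S : scheme) : Prop :=
  forall rho u v eps, 0 < rho -> 0 < theta S rho eps ->
    let p := rho * theta S rho eps in
    let q := Vec4 rho (rho * u) (rho * v)
               (rho * eps + / 2 * rho * (u ^ 2 + v ^ 2)) in
    let a := Vec4 rho u v p in
    fhat S a a = euler_f u p q /\ ghat S a a = euler_g v p q.

Definition contact_property (S : scheme) : Prop :=
  (forall rl rr v p, fhat S (Vec4 rl 0 v p) (Vec4 rr 0 v p) = Vec4 0 p 0 0) /\
  (forall rl rr u p, ghat S (Vec4 rl u 0 p) (Vec4 rr u 0 p) = Vec4 0 0 p 0).

Definition reproduces_constants (r : recon1d) : Prop := forall a, r a a a a = a.

(* At least three points per direction are needed for the ghost values and the
   wall reconstruction to refer to grid points. *)
Definition valid_scheme (S : scheme) : Prop :=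
  (3 <= Nx S)%Z /\ (3 <= Ny S)%Z /\
  xmin S < xmax S /\ ymin S < ymax S /\
  1 < gamma S /\ 1 <= kappa S <= 2 /\
  consistent_fluxes S /\ contact_property S /\
  reproduces_constants (recL S) /\ reproduces_constants (recR S).

(* On a periodic axis the first and last points are the same point of the
   periodic domain, so the potential and the data must agree there. *)
Definition periodic_data (S : scheme) (q : gridfun) : Prop :=
  (bcx S = Periodic ->
     (forall x y, phi S (x + (xmax S - xmin S)) y = phi S x y) /\
     (forall j, (1 <= j <= Ny S)%Z -> q 1%Z j = q (Nx S) j)) /\
  (bcy S = Periodic ->
     (forall x y, phi S x (y + (ymax S - ymin S)) = phi S x y) /\
     (forall i, (1 <= i <= Nx S)%Z -> q i 1%Z = q i (Ny S))).

Definition physical_data (S : scheme) (q : gridfun) : Prop :=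
  forall i j, on_grid S i j -> 0 < c1 (q i j) /\ 0 < theta_at S q i j.

(* The gravitational force -rho grad phi has no x component. *)
Definition gravity_along_y (S : scheme) : Prop :=
  forall x y, is_derive (fun s => phi S s y) x 0.

Definition function_of_y (S : scheme) (q : gridfun) : Prop :=
  forall i i' j, on_grid S i j -> on_grid S i' j -> q i j = q i' j.

(* Main.v *)
(* Along a vertical line the data satisfy p_j = K e^{psi_j}, so every point near
   a face gives the same value p e^{-psi} relative to that face, namely the
   hydrostatic pressure P = K e^{psi} at the face, and the contact property makes
   the flux there (0, 0, P, 0). Integrating over half a cell shows that the two
   pressures in the discrete gravity source are these face pressures, so source
   and flux difference cancel. Along a horizontal line psi_h = 0 and all data
   are constant; the fluxes through neighbouring faces are then equal, and an
   x wall forces U = 0, where the contact property gives the wall flux. *)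
Require Import Defs.
From Stdlib Require Import Reals ZArith Lra Lia.
From Coquelicot Require Import Coquelicot.
Open Scope R_scope.

(** * Nodes, faces and the piecewise form of [phi_h] and [theta_h] *)

Lemma Int_part_unique (r : R) (i : Z) : IZR i <= r < IZR i + 1 -> Int_part r = i.
Proof.
  intros H. symmetry. apply Int_part_spec. lra.
Qed.

Lemma node_succ l i : node l (i + 1) = node l i + ln_step l.
Proof.
  unfold node. replace (i + 1 - 1)%Z with (i - 1 + 1)%Z by lia.
  rewrite plus_IZR. ring.
Qed.

Lemma face_pred l i : face l (i - 1) = node l i - ln_step l / 2.
Proof.
  unfold face, node. rewrite !minus_IZR. field.
Qed.

Lemma scaled_coordinate l i s : 0 < ln_step l ->
  node l i < s < node l (i + 1) ->
  IZR (i - 1) < (s - ln_min l) / ln_step l < IZR (i - 1) + 1.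
Proof.
  intros hd. rewrite node_succ. unfold node. intros [h1 h2].
  split.
  - apply Rlt_div_r; lra.
  - apply Rlt_div_l; lra.
Qed.

(** Between two nodes the integer part inside [phi_h] does not change, so near [s] the function is a
    single affine one. The nodes, where the slope may jump, are excluded. *)
Lemma Derive_phi_h l i s : 0 < ln_step l ->
  node l i < s < node l (i + 1) ->
  Derive (phi_h l) s = (ln_phi l (i + 1)%Z - ln_phi l i) / ln_step l.
Proof.
  intros hd hs. apply is_derive_unique.
  apply (is_derive_ext_loc (fun s => ln_phi l i +
    ((s - ln_min l) / ln_step l - IZR (i - 1)) *
    (ln_phi l (i + 1)%Z - ln_phi l i))).
  - apply (locally_interval _ s (node l i) (node l (i + 1))); simpl; try lra.
    intros y h1 h2. unfold phi_h.
    pose proof (scaled_coordinate l i y hd (conj h1 h2)).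
    rewrite (Int_part_unique _ (i - 1)) by lra.
    replace (i - 1 + 1)%Z with i by lia. reflexivity.
  - auto_derive; [lra|]. field. lra.
Qed.

(** The cell is closed on the left because [Int_part] rounds down; [i] may be a ghost index. *)
Lemma theta_h_cell l i s : 0 < ln_step l ->
  node l i - ln_step l / 2 <= s < node l i + ln_step l / 2 ->
  theta_h l s = ln_theta l (ghost_src (ln_bc l) (ln_n l) i).
Proof.
  intros hd [h1 h2]. unfold theta_h, node in *.
  rewrite (Int_part_unique _ (i - 1)).
  - replace (i - 1 + 1)%Z with i by lia. reflexivity.
  - replace ((s - ln_min l) / ln_step l + / 2)
      with ((s - ln_min l + ln_step l / 2) / ln_step l) by (field; lra).
    split; [apply Rle_div_r | apply Rlt_div_l]; lra.
Qed.

(** * Half-cell integrals and integrability of the integrand of [psi_h] *)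

Definition theta_src (l : line) (i : Z) : R :=
  ln_theta l (ghost_src (ln_bc l) (ln_n l) i).

Notation psi_density l := (fun r => Derive (phi_h l) r / theta_h l r).

(** On half a cell the slope of [phi_h] and the value of [theta_h] are both fixed, so the integrand
    is the constant [c] on the open interval. This is all that [is_RInt_ext] asks for, so jumps at
    the node and the face are harmless. *)
Lemma is_RInt_right_half l i : 0 < ln_step l ->
  is_RInt (psi_density l) (node l i) (face l i)
    ((ln_phi l (i + 1)%Z - ln_phi l i) / (2 * theta_src l i)).
Proof.
  intros hd.
  set (c := (ln_phi l (i + 1)%Z - ln_phi l i) / ln_step l / theta_src l i).
  apply (is_RInt_ext (fun _ => c)).
  - unfold face. rewrite Rmin_left, Rmax_right by lra. intros s hs.
    rewrite (Derive_phi_h l i) by (rewrite ?node_succ; lra).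
    rewrite (theta_h_cell l i) by lra. reflexivity.
  - replace (_ / (2 * _)) with (scal (face l i - node l i) c).
    + apply (is_RInt_const (V := R_NormedModule)).
    + unfold scal, c, face; simpl; unfold mult; simpl.
      unfold Rdiv. rewrite Rinv_mult.
      replace (node l i + ln_step l * / 2 - node l i) with (ln_step l * / 2) by ring.
      transitivity ((ln_step l * / ln_step l) * (/ 2 * ((ln_phi l (i + 1) - ln_phi l i) * / theta_src l i))).
      ring. rewrite Rinv_r by lra. ring.
Qed.

Lemma is_RInt_left_half l i : 0 < ln_step l ->
  is_RInt (psi_density l) (face l (i - 1)) (node l i)
    ((ln_phi l i - ln_phi l (i - 1)%Z) / (2 * theta_src l i)).
Proof.
  intros hd.
  set (c := (ln_phi l i - ln_phi l (i - 1)%Z) / ln_step l / theta_src l i).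
  assert (hn : node l i = node l (i - 1) + ln_step l).
  { rewrite <- node_succ. f_equal. lia. }
  apply (is_RInt_ext (fun _ => c)).
  - rewrite face_pred, Rmin_left, Rmax_right by lra. intros s hs.
    rewrite (Derive_phi_h l (i - 1)) by (rewrite ?node_succ; lra).
    rewrite (theta_h_cell l i) by lra.
    replace (i - 1 + 1)%Z with i by lia. reflexivity.
  - replace (_ / (2 * _)) with (scal (node l i - face l (i - 1)) c).
    + apply (is_RInt_const (V := R_NormedModule)).
    + rewrite face_pred. unfold scal, c; simpl; unfold mult; simpl.
      unfold Rdiv. rewrite Rinv_mult.
      replace (node l i - (node l i - ln_step l * / 2)) with (ln_step l * / 2) by ring.
      transitivity ((ln_step l * / ln_step l) * (/ 2 * ((ln_phi l i - ln_phi l (i - 1)) * / theta_src l i))).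
      ring. rewrite Rinv_r by lra. ring.
Qed.

Lemma ex_RInt_cell l i : 0 < ln_step l ->
  ex_RInt (psi_density l) (node l i) (node l (i + 1)).
Proof.
  intros hd. apply ex_RInt_Chasles with (face l i).
  - eexists. apply is_RInt_right_half, hd.
  - eexists. replace i with (i + 1 - 1)%Z at 1 by lia.
    apply is_RInt_left_half, hd.
Qed.

Lemma ex_RInt_nodes l i j : 0 < ln_step l ->
  ex_RInt (psi_density l) (node l i) (node l j).
Proof.
  intros hd.
  assert (H : forall m : nat,
    ex_RInt (psi_density l) (node l i) (node l (i + Z.of_nat m)) /\
    ex_RInt (psi_density l) (node l i) (node l (i - Z.of_nat m))).
  { induction m as [|m [IH1 IH2]].
    - replace (i + Z.of_nat 0)%Z with i by lia.
      replace (i - Z.of_nat 0)%Z with i by lia.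
      split; apply ex_RInt_point.
    - split.
      + apply ex_RInt_Chasles with (1 := IH1).
        replace (i + Z.of_nat (S m))%Z with (i + Z.of_nat m + 1)%Z by lia.
        apply ex_RInt_cell, hd.
      + apply ex_RInt_Chasles with (1 := IH2). apply ex_RInt_swap.
        replace (i - Z.of_nat m)%Z with (i - Z.of_nat (S m) + 1)%Z by lia.
        apply ex_RInt_cell, hd. }
  destruct (Z_le_gt_dec i j).
  - destruct (H (Z.to_nat (j - i))) as [h _].
    replace (i + Z.of_nat (Z.to_nat (j - i)))%Z with j in h by lia. exact h.
  - destruct (H (Z.to_nat (i - j))) as [_ h].
    replace (i - Z.of_nat (Z.to_nat (i - j)))%Z with j in h by lia. exact h.
Qed.

(** Supplies the integrability on which additivity of [psi_h] rests. The integer part locates a cell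
    containing [x], and integrability on that cell restricts to the piece from [node l i] to [x]. *)
Lemma ex_RInt_psi_density l a c : 0 < ln_step l -> ex_RInt (psi_density l) a c.
Proof.
  intros hd.
  assert (H : forall x, ex_RInt (psi_density l) (node l 1) x).
  { intros x. set (r := (x - ln_min l) / ln_step l).
    set (i := (Int_part r + 1)%Z).
    assert (hx : node l i <= x <= node l (i + 1)).
    { rewrite node_succ. unfold node, i.
      replace (Int_part r + 1 - 1)%Z with (Int_part r) by lia.
      destruct (base_Int_part r) as [h1 h2].
      replace x with (ln_min l + r * ln_step l) by (unfold r; field; lra).
      split.
      - apply Rplus_le_compat_l, Rmult_le_compat_r; lra.
      - assert (r * ln_step l <= (IZR (Int_part r) + 1) * ln_step l)
          by (apply Rmult_le_compat_r; lra).
        lra. }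
    apply ex_RInt_Chasles with (node l i).
    - apply ex_RInt_nodes, hd.
    - apply (ex_RInt_Chasles_1 (V := R_CompleteNormedModule)) with (node l (i + 1)); [exact hx|].
      apply ex_RInt_cell, hd. }
  apply ex_RInt_Chasles with (node l 1); [apply ex_RInt_swap|]; apply H.
Qed.

(** * Additivity and increments of [psi_h] *)

Lemma psi_h_point l a : psi_h l a a = 0.
Proof.
  unfold psi_h. rewrite RInt_point. apply Ropp_0.
Qed.

Lemma psi_h_Chasles l a m c : 0 < ln_step l ->
  psi_h l a m + psi_h l m c = psi_h l a c.
Proof.
  intros hd. unfold psi_h.
  rewrite <- (RInt_Chasles (psi_density l) a m c)
    by (apply ex_RInt_psi_density, hd).
  unfold plus; simpl. ring.
Qed.

(** For a grid point this is the exponent in [pbarL]: the discrete source is built from exact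
    increments of [psi_h]. *)
Lemma psi_h_node_face l i : 0 < ln_step l ->
  psi_h l (node l i) (face l i) =
  - ((ln_phi l (i + 1)%Z - ln_phi l i) / (2 * theta_src l i)).
Proof.
  intros hd. unfold psi_h. f_equal. apply is_RInt_unique, is_RInt_right_half, hd.
Qed.

(** For a grid point this is minus the exponent in [pbarR]. *)
Lemma psi_h_face_node l i : 0 < ln_step l ->
  psi_h l (face l (i - 1)) (node l i) =
  - ((ln_phi l i - ln_phi l (i - 1)%Z) / (2 * theta_src l i)).
Proof.
  intros hd. unfold psi_h. f_equal. apply is_RInt_unique, is_RInt_left_half, hd.
Qed.

Lemma psi_h_cell l i : 0 < ln_step l ->
  psi_h l (node l i) (node l (i + 1)) =
  - ((ln_phi l (i + 1)%Z - ln_phi l i) / (2 * theta_src l i))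
  - (ln_phi l (i + 1)%Z - ln_phi l i) / (2 * theta_src l (i + 1)).
Proof.
  intros hd. rewrite <- (psi_h_Chasles l _ (face l i)) by exact hd.
  rewrite psi_h_node_face by exact hd.
  pose proof (psi_h_face_node l (i + 1) hd) as h.
  replace (i + 1 - 1)%Z with i in h by lia. rewrite h. reflexivity.
Qed.

Lemma psi_h_const_phi l c a s : (forall i, ln_phi l i = c) -> psi_h l a s = 0.
Proof.
  intros hc. unfold psi_h.
  rewrite (RInt_ext _ (fun _ => 0)).
  - rewrite RInt_const. unfold scal; simpl; unfold mult; simpl. ring.
  - intros x _. rewrite (Derive_ext _ (fun _ => c)).
    + rewrite Derive_const. apply Rmult_0_l.
    + intros t. unfold phi_h. rewrite !hc. ring.
Qed.

(** * Ghost indices and periodic lines *)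

Lemma ghost_src_id b n i : (1 <= i <= n)%Z -> ghost_src b n i = i.
Proof.
  intros h. destruct b; simpl; [|lia].
  destruct (Z.ltb_spec i 1); [lia|]. destruct (Z.ltb_spec n i); lia.
Qed.

Lemma ghost_src_range b n i :
  (3 <= n)%Z -> (-1 <= i <= n + 2)%Z -> (1 <= ghost_src b n i <= n)%Z.
Proof.
  intros hn h. destruct b; simpl; [|lia].
  destruct (Z.ltb_spec i 1); [lia|]. destruct (Z.ltb_spec n i); lia.
Qed.

(** The index period is [ln_n l - 1] because both ends are the same physical point. The pressure
    condition is what later forces [psi_h] to return to its value after one period. *)
Definition periodic_line (l : line) : Prop :=
  ln_bc l = Periodic ->
  (forall i, ln_phi l (i + (ln_n l - 1))%Z = ln_phi l i) /\
  ln_theta l 1%Z = ln_theta l (ln_n l) /\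
  c4 (ln_prim l 1%Z) = c4 (ln_prim l (ln_n l)).

(** An increment over a cell depends only on potential differences and on the two values of theta,
    all of which are periodic. The range of [i] covers the cells that lead to the ghost points at
    both ends. *)
Lemma psi_h_cell_periodic l i : 0 < ln_step l -> (3 <= ln_n l)%Z ->
  ln_bc l = Periodic -> periodic_line l -> (-1 <= i <= 2)%Z ->
  psi_h l (node l (i + (ln_n l - 1))) (node l (i + (ln_n l - 1) + 1)) =
  psi_h l (node l i) (node l (i + 1)).
Proof.
  intros hd hn hper hp hi. destruct (hp hper) as [hphi [hth _]].
  rewrite !psi_h_cell by exact hd.
  replace (i + (ln_n l - 1) + 1)%Z with (i + 1 + (ln_n l - 1))%Z by lia.
  rewrite !hphi.
  assert (Hth : forall m, (-1 <= m <= 3)%Z ->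
     theta_src l (m + (ln_n l - 1)) = theta_src l m).
  { intros m hm. unfold theta_src, ghost_src. rewrite hper.
    destruct (Z.ltb_spec (m + (ln_n l - 1)) 1); [lia|].
    destruct (Z.ltb_spec (ln_n l) (m + (ln_n l - 1)));
    destruct (Z.ltb_spec m 1); try lia;
    destruct (Z.ltb_spec (ln_n l) m); try lia.
    - f_equal. lia.
    - f_equal. lia.
    (* The index 1 is the only one whose source differs from that of its translate, so equality of
       theta at the two ends enters here. *)
    - replace m with 1%Z by lia. rewrite hth. f_equal. lia. }
  rewrite !Hth by lia. reflexivity.
Qed.

(** * Hydrostatic data along one line *)

Section Hydrostatic.

Variables (l : line) (b U K : R).
Hypothesis hd : 0 < ln_step l.
Hypothesis hn : (3 <= ln_n l)%Z.
Hypothesis hK : K <> 0.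
Hypothesis hper : periodic_line l.
Hypothesis hu : forall i, (1 <= i <= ln_n l)%Z -> c2 (ln_prim l i) = U.
Hypothesis hv : forall i, (1 <= i <= ln_n l)%Z -> c3 (ln_prim l i) = 0.
Hypothesis hp : forall i, (1 <= i <= ln_n l)%Z ->
  c4 (ln_prim l i) = K * exp (psi_h l b (node l i)).

(** A periodic potential alone does not make [psi_h] periodic, since theta varies. Equal pressures
    at the two ends, [K <> 0] and injectivity of [exp] give zero increment over one period; equal
    increments over translated cells carry this to the ghost points. *)
Lemma psi_h_ghost i : ln_bc l = Periodic -> (-1 <= i <= ln_n l + 2)%Z ->
  psi_h l b (node l i) =
  psi_h l b (node l (ghost_src (ln_bc l) (ln_n l) i)).
Proof.
  intros hbc hi.
  assert (h1n : psi_h l b (node l 1) = psi_h l b (node l (ln_n l))).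
  { destruct (hper hbc) as [_ [_ h]]. rewrite !hp in h by lia.
    apply exp_inv. apply Rmult_eq_reg_l with K; assumption. }
  (* True at 1 and moved by one index at a time. The values -1 and 0 serve the lower ghost points, 2
     and 3 the upper ones. *)
  set (shifted := fun m => psi_h l b (node l (m + (ln_n l - 1))) =
                           psi_h l b (node l m)).
  assert (hstep : forall m, (-1 <= m <= 2)%Z -> shifted m <-> shifted (m + 1)%Z).
  { intros m hm. unfold shifted.
    pose proof (psi_h_cell_periodic l m hd hn hbc hper hm) as hc.
    pose proof (psi_h_Chasles l b (node l m) (node l (m + 1)) hd).
    pose proof (psi_h_Chasles l b (node l (m + (ln_n l - 1)))
      (node l (m + (ln_n l - 1) + 1)) hd).
    replace (m + 1 + (ln_n l - 1))%Z with (m + (ln_n l - 1) + 1)%Z by lia.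
    lra. }
  assert (s1 : shifted 1%Z).
  { unfold shifted. replace (1 + (ln_n l - 1))%Z with (ln_n l) by lia.
    symmetry. exact h1n. }
  assert (s0 : shifted 0%Z) by (apply hstep; [lia | exact s1]).
  assert (sm1 : shifted (-1)%Z) by (apply hstep; [lia | exact s0]).
  assert (s2 : shifted 2%Z) by (apply (hstep 1%Z); [lia | exact s1]).
  assert (s3 : shifted 3%Z) by (apply (hstep 2%Z); [lia | exact s2]).
  assert (hs : forall m, (-1 <= m <= 3)%Z -> shifted m).
  { intros m hm.
    assert (hm' : (m = -1 \/ m = 0 \/ m = 1 \/ m = 2 \/ m = 3)%Z) by lia.
    destruct hm' as [-> | [-> | [-> | [-> | ->]]]]; assumption. }
  rewrite hbc. simpl.
  destruct (Z.ltb_spec i 1).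
  - rewrite <- (hs i) by lia. f_equal. f_equal. lia.
  - destruct (Z.ltb_spec (ln_n l) i); [|reflexivity].
    rewrite <- (hs (i + 1 - ln_n l)%Z) by lia. f_equal. f_equal. lia.
Qed.

(** By additivity the exponent collapses to the increment of [psi_h] from [b] to the face, so [i]
    drops out. The density component remains free, as the contact property allows. *)
Lemma w_at_hydrostatic k i : (-1 <= i <= ln_n l + 2)%Z ->
  c2 (w_at l k i) = U /\ c3 (w_at l k i) = 0 /\
  c4 (w_at l k i) = K * exp (psi_h l b (face l k)).
Proof.
  intros hi. unfold w_at.
  set (m := match ln_bc l with Periodic => i | _ => _ end).
  (* Both kinds of ghost point reduce to one fact: [psi_h] agrees at the node where it is evaluated
     and at the point that supplies the data. With copied [w] these are the same point; in the
     periodic case [psi_h_ghost] applies. *)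
  assert (hs : (1 <= ghost_src (ln_bc l) (ln_n l) m <= ln_n l)%Z /\
     psi_h l b (node l m) =
     psi_h l b (node l (ghost_src (ln_bc l) (ln_n l) m))).
  { unfold m. destruct (ln_bc l) as [|lo hi'] eqn:hbc.
    - split; [apply ghost_src_range; lia|].
      rewrite <- hbc. apply psi_h_ghost; assumption.
    - pose proof (ghost_src_range (Bounded lo hi') (ln_n l) i hn hi) as h.
      rewrite (ghost_src_id _ _ (ghost_src _ _ _)) by exact h. auto. }
  destruct hs as [hs hpsi]. simpl.
  repeat split; [apply hu, hs | apply hv, hs |].
  rewrite hp by exact hs. rewrite <- hpsi.
  rewrite Rmult_assoc, <- exp_plus. f_equal. f_equal.
  rewrite <- (psi_h_Chasles l b (face l k) (node l m) hd). ring.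
Qed.

Lemma pbarL_hydrostatic i : (1 <= i <= ln_n l)%Z ->
  pbarL l i = K * exp (psi_h l b (face l i)).
Proof.
  intros hi. unfold pbarL. rewrite hp by exact hi.
  rewrite Rmult_assoc, <- exp_plus. f_equal. f_equal.
  rewrite <- (psi_h_Chasles l b (node l i) (face l i) hd).
  rewrite psi_h_node_face by exact hd. unfold theta_src.
  rewrite ghost_src_id by exact hi. ring.
Qed.

Lemma pbarR_hydrostatic i : (1 <= i <= ln_n l)%Z ->
  pbarR l i = K * exp (psi_h l b (face l (i - 1))).
Proof.
  intros hi. unfold pbarR. rewrite hp by exact hi.
  rewrite Rmult_assoc, <- exp_plus. f_equal. f_equal.
  rewrite <- (psi_h_Chasles l b (face l (i - 1)) (node l i) hd).
  rewrite psi_h_face_node by exact hd. unfold theta_src.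
  rewrite ghost_src_id by exact hi. ring.
Qed.

End Hydrostatic.

(** * Reconstruction of constants and flux differences along a line *)

Lemma minmod_0 : minmod 0 0 0 = 0.
Proof.
  unfold minmod. rewrite sign_0.
  destruct (Req_EM_T 0 0); [ring | reflexivity].
Qed.

(** Components are treated one by one because on a hydrostatic line only the last three are constant
    across the stencil. *)
Definition is_component (c : vec4 -> R) : Prop :=
  c = Defs.c1 \/ c = c2 \/ c = c3 \/ c = c4.

Lemma component_ops c : is_component c ->
  (forall a b, c (vadd a b) = c a + c b) /\
  (forall a b, c (vsub a b) = c a - c b) /\
  (forall r a, c (vscale r a) = r * c a) /\
  (forall x y z, c (vminmod x y z) = minmod (c x) (c y) (c z)) /\
  (forall r x y z t, c (vrecon r x y z t) = r (c x) (c y) (c z) (c t)).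
Proof.
  intros [-> | [-> | [-> | ->]]]; repeat split.
Qed.

(** Away from walls this is reproduction of constants; in the wall formulas every difference
    vanishes, and with it the minmod correction. *)
Lemma reconstruction_const c rL rR kap l k x :
  is_component c -> reproduces_constants rL -> reproduces_constants rR ->
  (forall i, (k - 1 <= i <= k + 2)%Z -> c (w_at l k i) = x) ->
  c (w_left rL kap l k) = x /\ c (w_right rR kap l k) = x.
Proof.
  intros hc hL hR hw.
  destruct (component_ops c hc) as [Ha [Hs [Hk [Hm Hr]]]].
  unfold w_left, w_right, at_lo_face, at_hi_face.
  (* The wall formulas use the first or the last three points, all of which lie between [k - 1] and
     [k + 2] for the face in question. *)
  destruct (Z.eqb_spec k 1); destruct (Z.eqb_spec k (ln_n l - 1));
    destruct (lo_wall (ln_bc l)); destruct (hi_wall (ln_bc l)); simpl;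
    rewrite ?Ha, ?Hs, ?Hk, ?Hm, ?Hr, ?Hs, ?Hk, ?Hs, !hw, ?Rminus_diag,
      ?Rmult_0_r, ?minmod_0, ?hL, ?hR by lia;
    split; try reflexivity; ring.
Qed.

Lemma of_w_0 w : of_w 0 w = w.
Proof.
  destruct w. unfold of_w; simpl. rewrite exp_0, !Rmult_1_r. reflexivity.
Qed.

Lemma to_w_0 p : to_w 0 p = p.
Proof.
  destruct p. unfold to_w; simpl. rewrite Ropp_0, exp_0, !Rmult_1_r. reflexivity.
Qed.

(** The face pressures given by the contact property are the pressures in [grav_force]. In a wall
    cell the wall pressure occurs in both quotients, over the same half step. *)
Lemma flux_div_hydrostatic l b U K F rL rR kap i :
  0 < ln_step l -> (3 <= ln_n l)%Z -> K <> 0 -> periodic_line l ->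
  (forall j, (1 <= j <= ln_n l)%Z -> c2 (ln_prim l j) = U) ->
  (forall j, (1 <= j <= ln_n l)%Z -> c3 (ln_prim l j) = 0) ->
  (forall j, (1 <= j <= ln_n l)%Z ->
     c4 (ln_prim l j) = K * exp (psi_h l b (node l j))) ->
  reproduces_constants rL -> reproduces_constants rR ->
  (forall rl rr p, F (Vec4 rl U 0 p) (Vec4 rr U 0 p) = Vec4 0 0 p 0) ->
  (1 <= i <= ln_n l)%Z ->
  flux_div F wall_flux_y rL rR kap l i = Vec4 0 0 (grav_force l i) 0.
Proof.
  intros hd hn hK hper hu hv hp hL hR hF hi.
  assert (hface : forall k, (0 <= k <= ln_n l)%Z ->
    face_flux F rL rR kap l k = Vec4 0 0 (K * exp (psi_h l b (face l k))) 0).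
  (* Since [psi_h] is zero at its own face, [w] and the primitive variables coincide there. *)
  { intros k hk. unfold face_flux. rewrite psi_h_point, !of_w_0.
    assert (hw : forall j, (k - 1 <= j <= k + 2)%Z -> _) by
      (intros j hj; apply (w_at_hydrostatic l b U K hd hn hK hper hu hv hp k j);
       lia).
    destruct (reconstruction_const c2 rL rR kap l k U) as [e2 e2'];
      [unfold is_component; tauto | exact hL | exact hR | apply hw |].
    destruct (reconstruction_const c3 rL rR kap l k 0) as [e3 e3'];
      [unfold is_component; tauto | exact hL | exact hR | apply hw |].
    destruct (reconstruction_const c4 rL rR kap l k
      (K * exp (psi_h l b (face l k)))) as [e4 e4'];
      [unfold is_component; tauto | exact hL | exact hR | apply hw |].
    destruct (w_left rL kap l k), (w_right rR kap l k). simpl in *.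
    rewrite e2, e2', e3, e3', e4, e4'. apply hF. }
  pose proof (pbarL_hydrostatic l b K hd hp i hi) as HL.
  pose proof (pbarR_hydrostatic l b K hd hp i hi) as HR.
  unfold flux_div, grav_force, wall_flux_y.
  destruct (lo_wall (ln_bc l) && (i =? 1)%Z)%bool eqn:E1.
  - apply andb_prop in E1. destruct E1 as [_ E1]. apply Z.eqb_eq in E1. subst i.
    rewrite hface by lia. rewrite HL. unfold vscale, vsub, vmap2; simpl.
    unfold Rdiv. f_equal; ring.
  - destruct (hi_wall (ln_bc l) && (i =? ln_n l)%Z)%bool.
    + rewrite hface by lia. rewrite HR. unfold vscale, vsub, vmap2; simpl.
      unfold Rdiv. f_equal; ring.
    + rewrite !hface by lia. rewrite HL, HR. unfold vscale, vsub, vmap2; simpl.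
      unfold Rdiv. f_equal; ring.
Qed.

(** With zero [psi_h] both states at each face equal [a], so neighbouring fluxes cancel. The value
    of [F a a] matters only at a wall, where it has to match the wall flux. *)
Lemma flux_div_uniform l a ph F wf rL rR kap i :
  (3 <= ln_n l)%Z ->
  (forall j, ln_phi l j = ph) ->
  (forall j, (1 <= j <= ln_n l)%Z -> ln_prim l j = a) ->
  reproduces_constants rL -> reproduces_constants rR ->
  ((lo_wall (ln_bc l) || hi_wall (ln_bc l))%bool = true -> F a a = wf (c4 a)) ->
  (1 <= i <= ln_n l)%Z ->
  flux_div F wf rL rR kap l i = Vec4 0 0 0 0.
Proof.
  intros hn hph ha hL hR hF hi.
  assert (hface : forall k, (0 <= k <= ln_n l)%Z ->
    face_flux F rL rR kap l k = F a a).
  { intros k hk. unfold face_flux. rewrite psi_h_point, !of_w_0.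
    assert (hw : forall j, (k - 1 <= j <= k + 2)%Z -> w_at l k j = a).
    { intros j hj. unfold w_at. rewrite (psi_h_const_phi l ph) by exact hph.
      rewrite to_w_0. apply ha.
      destruct (ln_bc l) eqn:hbc; [apply ghost_src_range; lia|].
      rewrite (ghost_src_id _ _ (ghost_src _ _ _)); apply ghost_src_range; lia. }
    assert (hc : forall c, is_component c ->
      c (w_left rL kap l k) = c a /\ c (w_right rR kap l k) = c a).
    { intros c hc. apply reconstruction_const; try assumption.
      intros j hj. f_equal. apply hw, hj. }
    destruct (hc Defs.c1) as [e1 e1']; [unfold is_component; tauto|].
    destruct (hc c2) as [e2 e2']; [unfold is_component; tauto|].
    destruct (hc c3) as [e3 e3']; [unfold is_component; tauto|].
    destruct (hc c4) as [e4 e4']; [unfold is_component; tauto|].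
    destruct (w_left rL kap l k), (w_right rR kap l k), a; simpl in *.
    subst; reflexivity. }
  assert (hzero : forall r v, vscale r (vsub v v) = Vec4 0 0 0 0).
  { intros r v. unfold vscale, vsub, vmap2; simpl.
    rewrite !Rminus_diag, !Rmult_0_r. reflexivity. }
  unfold flux_div. rewrite (ha i hi).
  destruct (lo_wall (ln_bc l)); simpl in *.
  - rewrite <- (hF eq_refl).
    destruct (Z.eqb_spec i 1); [rewrite hface by lia; apply hzero|].
    destruct (hi_wall (ln_bc l) && _)%bool; rewrite !hface by lia; apply hzero.
  - destruct (hi_wall (ln_bc l)); simpl in *.
    + rewrite <- (hF eq_refl).
      destruct (Z.eqb_spec i (ln_n l)); rewrite !hface by lia; apply hzero.
    + rewrite !hface by lia; apply hzero.
Qed.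

Lemma grav_force_uniform l a ph i :
  (forall j, ln_phi l j = ph) -> c4 (ln_prim l i) = a -> grav_force l i = 0.
Proof.
  intros hph ha.
  assert (hL : pbarL l i = a).
  { unfold pbarL. rewrite !hph, Rminus_diag, ha. unfold Rdiv.
    rewrite Rmult_0_l, Ropp_0, exp_0. ring. }
  assert (hR : pbarR l i = a).
  { unfold pbarR. rewrite !hph, Rminus_diag, ha. unfold Rdiv.
    rewrite Rmult_0_l, exp_0. ring. }
  unfold grav_force. rewrite hL, hR, ha.
  destruct (lo_wall (ln_bc l) && _)%bool; [unfold Rdiv; ring|].
  destruct (hi_wall (ln_bc l) && _)%bool; unfold Rdiv; ring.
Qed.

(** * Independence of the horizontal coordinate *)

Lemma gravity_along_y_const S x x' y :
  gravity_along_y S -> phi S x y = phi S x' y.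
Proof.
  intros hg.
  assert (H : forall s t, s < t -> phi S s y = phi S t y).
  { intros s t hst. apply (eq_is_derive (fun s => phi S s y) s t); [|exact hst].
    intros r _. apply hg. }
  destruct (Rtotal_order x x') as [h | [h | h]].
  - apply H, h.
  - subst. reflexivity.
  - symmetry. apply H, h.
Qed.

Lemma dy_pos S : (3 <= Ny S)%Z -> ymin S < ymax S -> 0 < dy S.
Proof.
  intros hn hy. unfold dy. apply Rdiv_lt_0_compat; [lra|]. apply IZR_lt. lia.
Qed.

(** Equal conserved values do not settle this alone, because [vel_x] is set to zero at an x wall;
    the uniform velocities make the internal energies agree. *)
Lemma theta_at_function_of_y S q U i i' j :
  function_of_y S q -> on_grid S i j -> on_grid S i' j ->
  (forall i j, on_grid S i j -> vel_x S q i j = U) ->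
  (forall i j, on_grid S i j -> vel_y S q i j = 0) ->
  theta_at S q i j = theta_at S q i' j.
Proof.
  intros hy hi hi' hu hv. unfold theta_at, rho_eps.
  rewrite !hu, !hv, (hy i i' j) by assumption. reflexivity.
Qed.

(** With both limits inside the grid, the cell index in [theta_h] stays between 1 and [ln_n l],
    where the values of theta are known to agree. *)
Lemma psi_h_ext l l' a c : 0 < ln_step l ->
  ln_n l = ln_n l' -> ln_min l = ln_min l' -> ln_step l = ln_step l' ->
  ln_bc l = ln_bc l' ->
  (forall i, ln_phi l i = ln_phi l' i) ->
  (forall i, (1 <= i <= ln_n l)%Z -> ln_theta l i = ln_theta l' i) ->
  node l 1 <= a <= node l (ln_n l) -> node l 1 <= c <= node l (ln_n l) ->
  psi_h l a c = psi_h l' a c.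
Proof.
  intros hd en em es eb ephi eth ha hc. unfold psi_h. f_equal.
  apply RInt_ext. intros s hs.
  assert (hs' : node l 1 < s < node l (ln_n l)).
  { revert hs. unfold Rmin, Rmax. destruct (Rle_dec a c); lra. }
  f_equal.
  - apply Derive_ext. intros t. unfold phi_h. rewrite <- em, <- es, !ephi.
    reflexivity.
  - unfold theta_h. rewrite <- em, <- es, <- eb, <- en.
    set (r := (s - ln_min l) / ln_step l).
    assert (hr : 0 < r < IZR (ln_n l) - 1).
    { unfold node in hs'. rewrite !minus_IZR in hs'. unfold r.
      split; [apply Rlt_div_r | apply Rlt_div_l]; lra. }
    destruct (base_Int_part (r + / 2)) as [h1 h2].
    assert (0 < Int_part (r + / 2) + 1)%Z
      by (apply lt_IZR; rewrite plus_IZR; lra).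
    assert (Int_part (r + / 2) < ln_n l)%Z by (apply lt_IZR; lra).
    rewrite ghost_src_id by lia. apply eth. lia.
Qed.

Lemma node_column S q i j : node (column S q i) j = ypt S j.
Proof.
  reflexivity.
Qed.

Lemma ypt_last S : (3 <= Ny S)%Z -> ypt S (Ny S) = ymax S.
Proof.
  intros hn. unfold ypt, dy. field. apply not_0_IZR. lia.
Qed.

Lemma ypt_range S j : (3 <= Ny S)%Z -> ymin S < ymax S ->
  (1 <= j <= Ny S)%Z -> ypt S 1 <= ypt S j <= ypt S (Ny S).
Proof.
  intros hn hm hj. pose proof (dy_pos S hn hm) as hd. unfold ypt.
  split; apply Rplus_le_compat_l, Rmult_le_compat_r; try lra;
    apply IZR_le; lia.
Qed.

(** * Assembly: the right-hand side vanishes at every grid point *)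

Theorem theorem4 (S : scheme) (q0 : gridfun) (b U K : R)
  (hS : valid_scheme S)
  (hphys : physical_data S q0)
  (hper : periodic_data S q0)
  (hwall : no_penetration S q0)
  (hgrav : gravity_along_y S)
  (hy : function_of_y S q0)
  (hb : ymin S <= b <= ymax S)
  (hu : forall i j, on_grid S i j -> vel_x S q0 i j = U)
  (hv : forall i j, on_grid S i j -> vel_y S q0 i j = 0)
  (hp : forall i j, on_grid S i j ->
          pres S q0 i j * exp (- psi_y S q0 b i j) = K) :
  exactly_preserved S q0.
Proof.
  destruct hS as (hnx & hny & hxm & hym & _ & _ & _ & [hcf hcg] & hL & hR).
  pose proof (dy_pos S hny hym) as hd.
  assert (hpres : forall i j, on_grid S i j ->
    pres S q0 i j = K * exp (psi_y S q0 b i j)).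
  { intros i j hij. rewrite <- (hp i j hij), Rmult_assoc, <- exp_plus.
    rewrite Rplus_opp_l, exp_0. ring. }
  assert (hK : K <> 0).
  (* The point (2, 2) is on no wall, as each direction has at least three points. Its pressure is
     therefore [rho * theta], whose factors are positive by [hphys]. *)
  { assert (h22 : on_grid S 2 2) by (split; lia).
    assert (hw : forall bc n, (3 <= n)%Z -> on_wall bc n 2 = false).
    { intros bc n hn. unfold on_wall.
      replace (2 =? n)%Z with false by (symmetry; apply Z.eqb_neq; lia).
      simpl. rewrite !Bool.andb_false_r. reflexivity. }
    rewrite <- (hp 2%Z 2%Z h22). apply Rgt_not_eq, Rmult_lt_0_compat;
      [|apply exp_pos].
    unfold pres, wall_x, wall_y. rewrite !hw by assumption. simpl.
    destruct (hphys 2%Z 2%Z h22). apply Rmult_lt_0_compat; assumption. }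
  assert (hpsi : forall i i' j, on_grid S i j -> on_grid S i' j ->
    psi_y S q0 b i j = psi_y S q0 b i' j).
  { intros i i' j hi hi'. unfold psi_y.
    apply psi_h_ext; try reflexivity; try exact hd.
    - intros m. apply gravity_along_y_const, hgrav.
    - intros m hm. simpl in *. destruct hi, hi'.
      apply (theta_at_function_of_y S q0 U); try assumption; split; assumption.
    - rewrite !node_column. simpl ln_n. rewrite ypt_last by exact hny.
      replace (ypt S 1) with (ymin S) by (unfold ypt; simpl; ring). exact hb.
    - rewrite !node_column. apply ypt_range; try assumption. apply hi. }
  (* Pressure has a different formula at wall points, so its equality across columns comes from the
     hydrostatic relation and [hpsi], not from [hy] alone. *)
  assert (hprim : forall i i' j, on_grid S i j -> on_grid S i' j ->
    prim S q0 i j = prim S q0 i' j).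
  { intros i i' j hi hi'. unfold prim.
    rewrite !hu, !hv, !hpres, (hy i i' j), (hpsi i i' j) by assumption.
    reflexivity. }
  assert (hwallU : (lo_wall (bcx S) || hi_wall (bcx S))%bool = true -> U = 0).
  { intros h. apply Bool.orb_true_iff in h. destruct h as [h | h].
    - rewrite <- (hu 1%Z 1%Z) by (split; lia).
      unfold vel_x, wall_x, on_wall. rewrite h. reflexivity.
    - rewrite <- (hu (Nx S) 1%Z) by (split; lia).
      unfold vel_x, wall_x, on_wall. rewrite h, Z.eqb_refl. simpl.
      rewrite Bool.orb_true_r. reflexivity. }
  assert (hrhs : forall i j, on_grid S i j ->
    scheme_rhs S q0 i j = Vec4 0 0 0 0).
  { intros i j hij. pose proof hij as [hi hj].
    assert (hrow : forall m, ln_phi (row S q0 j) m = phi S (xpt S i) (ypt S j))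
      by (intros m; apply gravity_along_y_const, hgrav).
    unfold scheme_rhs, source.
    rewrite (grav_force_uniform (row S q0 j) _ _ i hrow eq_refl).
    rewrite (flux_div_uniform (row S q0 j) (prim S q0 i j) _ _ _ _ _ _ _ hnx hrow);
      try assumption.
    2: { intros m hm. apply hprim; [split; assumption | exact hij]. }
    (* An x wall forces [U = 0], so the contact property with equal densities yields the wall
       flux. *)
    2: { intros h. unfold prim. rewrite hu by exact hij.
         rewrite (hwallU h). apply hcf. }
    rewrite (flux_div_hydrostatic (column S q0 i) b U K); try assumption.
    (* The energy source vanishes because [alpha] and the vertical velocity are both zero. *)
    - rewrite hv by exact hij. unfold vsub, vmap2; simpl. f_equal; ring.
    - intros hbc. simpl in *. destruct hper as [_ hpy].
      destruct (hpy hbc) as [hphi hq].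
      assert (h1 : on_grid S i 1) by (split; lia).
      assert (h2 : on_grid S i (Ny S)) by (split; lia).
      assert (hre : rho_eps S q0 i 1 = rho_eps S q0 i (Ny S)).
      { unfold rho_eps. rewrite !hu, !hv, (hq i hi) by assumption. reflexivity. }
      assert (hth : theta_at S q0 i 1 = theta_at S q0 i (Ny S)).
      { unfold theta_at. rewrite hre, (hq i hi). reflexivity. }
      repeat split.
      (* Shifting the index by [Ny S - 1] moves [ypt] by [ymax S - ymin S], the period of the
         potential. *)
      + intros m. rewrite <- (hphi (xpt S i) (ypt S m)). f_equal.
        rewrite <- (ypt_last S hny) at 1. unfold ypt.
        rewrite !minus_IZR, plus_IZR, minus_IZR. ring.
      + exact hth.
      (* Neither end of a periodic axis is a wall in y, so both ends use the same pressure
         formula. *)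
      + unfold pres, wall_y, on_wall. rewrite hbc, hre, hth, (hq i hi).
        reflexivity.
    - intros m hm. apply hu. split; assumption.
    - intros m hm. apply hv. split; assumption.
    - intros m hm. apply hpres. split; assumption.
    - intros rl rr p. apply hcg. }
  intros t. split; [exact hwall|].
  intros i j hij. rewrite hrhs by exact hij.
  split; [|split; [|split]]; apply (is_derive_const (V := R_NormedModule)).
Qed.
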